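(* Let $X,Y$ be compact metric spaces, $S$ a real Banach space, $\mathcal{F}\subset S^*$ a linear subspace separating the points of $S$, $\mu\in\mathcal{M}(X,S)$, $\nu\in\mathcal{M}(Y,S)$, $c\in C(X\times Y)$, and let $\eta:X\times Y\to S$ be norm bounded and continuous with respect to the topology $w(\mathcal{F})$ on $S$. Assume that there exists $f\in C(X,\mathcal{F})$ such that $\langle f(x),\eta(x,y)\rangle=1$ for all $(x,y)\in X\times Y$. Then $$\min_{\pi\in\Pi(\mu,\nu,\eta)}\int_{X\times Y}c(x,y)\,d\pi(x,y)=\sup_{(\psi,\varphi)\in\Phi(c,\eta)}\int_X\psi(x)\,d\mu(x)+\int_Y\varphi(y)\,d\nu(y).$$
   Context: Metric spaces carry their Borel $\sigma$-algebras. $\mathcal{M}_+(\Omega)$ is the set of finite non-negative (Borel) measures on $\Omega$. $\mathcal{M}(\Omega,S)$ is the set of $S$-valued measures $\mu$ of the form $\mu(A)=\int_A\eta_0\,d|\mu|$ (Bochner integral) for some $|\mu|\in\mathcal{M}_+(\Omega)$ and some Bochner integrable $\eta_0:\Omega\to S$; one writes $\eta_0=\frac{d\mu}{d|\mu|}$. For $f:\Omega\to S^*$, $\int_\Omega f\,d\mu:=\int_\Omega\langle f(\omega),\frac{d\mu}{d|\mu|}(\omega)\rangle\,d|\mu|(\omega)$ (this does not depend on the representation of $\mu$). $w(\mathcal{F})$ is the weak topology on $S$ generated by the functionals in $\mathcal{F}$. $C(X,\mathcal{F})$ and $C(Y,\mathcal{F})$ are the spaces of continuous functions into $\mathcal{F}$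 with the norm of $S^*$; $C(X\times Y)$ is the space of continuous real functions. $\Pi(\mu,\nu,\eta)$ is the set of scalar measures $\pi\in\mathcal{M}_+(X\times Y)$ such that for every $\psi\in C(X,\mathcal{F})$, $\varphi\in C(Y,\mathcal{F})$ $$\int_X\psi\,d\mu+\int_Y\varphi\,d\nu=\int_{X\times Y}\langle\psi(x)+\varphi(y),\eta(x,y)\rangle\,d\pi(x,y).$$ $\Phi(c,\eta)=\{(\psi,\varphi)\in C(X,\mathcal{F})\times C(Y,\mathcal{F}):\ \langle\psi(x)+\varphi(y),\eta(x,y)\rangle\le c(x,y)\ \forall x,y\}$. The minimum over the empty set is $+\infty$; ''min'' means that the infimum is attained when $\Pi(\mu,\nu,\eta)\neq\emptyset$. *)

(* Defs.v *)
From HB Require Import structures.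
From mathcomp Require Import all_boot all_order all_algebra.
From mathcomp Require Import all_classical all_reals all_analysis.
Set Implicit Arguments.
Unset Strict Implicit.
Unset Printing Implicit Defensive.
Import Order.TTheory GRing.Theory Num.Def Num.Theory.
Import numFieldNormedType.Exports.
Local Open Scope classical_set_scope.
Local Open Scope ring_scope.

(* Measurable types are pointed in the library, so the metric spaces that carry
   a Borel sigma-algebra below are nonempty ones. *)
#[short(type="pointedMetricType")]
HB.structure Definition PointedMetric (R : numDomainType) :=
  {M of Metric R M & isPointed M}.

Notation borel T := (g_sigma_algebraType (@open T)).

Section dual.
Context {R : realType} {S : normedModType R}.

Definition continuous_linear_form : {pred S -> R^o} :=
  mem [set l : S -> R^o | linear l /\ continuous l].

Fact continuous_linear_form_submod : submod_closed continuous_linear_form.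
Proof.
split.
  rewrite inE; split; first by move=> a x y /=; rewrite scaler0 addr0.
  exact: cst_continuous.
move=> a l1 l2; rewrite !inE => -[L1 C1] [L2 C2]; split.
  move=> b x y /=; rewrite !fctE L1 L2 !scalerDr !scalerA (mulrC a b).
  by rewrite addrACA.
by move=> x; apply: cvgD; [apply: cvgZr; exact: C1|exact: C2].
Qed.

HB.instance Definition _ := GRing.isSubmodClosed.Build R (S -> R^o)
  continuous_linear_form continuous_linear_form_submod.
End dual.

Record dual (R : realType) (S : normedModType R) := Dual {
  dual_fun :> S -> R^o ;
  dual_prop : dual_fun \in continuous_linear_form }.

Section dual_norm.
Context (R : realType) (S : normedModType R).

HB.instance Definition _ := [isSub of dual S for @dual_fun R S].
HB.instance Definition _ := [Choice of dual S by <:].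
HB.instance Definition _ := [SubChoice_isSubLmodule of dual S by <:].

Implicit Types l : dual S.

Lemma dualP l : linear l /\ continuous l.
Proof. by have := dual_prop l; rewrite inE. Qed.

HB.instance Definition _ l := GRing.isLinear.Build R S R^o *:%R l (dualP l).1.

Lemma dualD l1 l2 x : (l1 + l2) x = l1 x + l2 x.
Proof. by []. Qed.

Lemma dualZ a l x : (a *: l) x = a * l x.
Proof. by []. Qed.

Lemma dual_ext l1 l2 : (forall x, l1 x = l2 x) -> l1 = l2.
Proof. by move=> e; apply: val_inj; apply/funext. Qed.

Definition dual_values l : set R := [set `|l x| | x in [set x : S | `|x| <= 1]].

Definition dual_norm l : R := sup (dual_values l).

Lemma dual_values_has_sup l : has_sup (dual_values l).
Proof.
split; first by exists `|l 0|; exists 0; rewrite //= normr0.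
have := @continuous_linear_bounded R S R^o 0 l ((dualP l).2 0).
move/(@linear_boundedP R S R^o l) => /pinfty_ex_gt0 [M M0 H].
exists M => _ [x /= x1 <-]; rewrite (le_trans (H x))//.
by rewrite ler_piMr// ltW.
Qed.

Lemma dual_norm_ub l x : `|x| <= 1 -> `|l x| <= dual_norm l.
Proof.
by move=> x1; apply: sup_upper_bound; [exact: dual_values_has_sup|exists x].
Qed.

Lemma dual_norm_le l M : (forall x, `|x| <= 1 -> `|l x| <= M) ->
  dual_norm l <= M.
Proof.
move=> H; apply: ge_sup; first by case: (dual_values_has_sup l).
by move=> _ [x /= x1 <-]; exact: H.
Qed.

Lemma ler_dual_norm l x : `|l x| <= dual_norm l * `|x|.
Proof.
have [->|x0] := eqVneq x 0; first by rewrite linear0 !normr0 mulr0.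
have nx : 0 < `|x| by rewrite normr_gt0.
rewrite -ler_pdivrMr// mulrC -[X in X * _](@ger0_norm _ `|x|^-1)//.
rewrite -normrM -[_ * l x]/(_ *: l x) -linearZ; apply: dual_norm_ub.
by rewrite normrZ ger0_norm ?invr_ge0// mulVf// gt_eqF.
Qed.

Fact dual_normD l1 l2 : dual_norm (l1 + l2) <= dual_norm l1 + dual_norm l2.
Proof.
apply: dual_norm_le => x x1; rewrite dualD (le_trans (ler_normD _ _))//.
by rewrite lerD// dual_norm_ub.
Qed.

Fact dual_normZ (a : R) l : dual_norm (a *: l) = `|a| * dual_norm l.
Proof.
have le1 (b : R) k : dual_norm (b *: k) <= `|b| * dual_norm k.
  apply: dual_norm_le => x x1.
  by rewrite dualZ normrM ler_wpM2l// dual_norm_ub.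
apply/eqP; rewrite eq_le le1/=.
have [->|a0] := eqVneq a 0.
  by rewrite normr0 mul0r (le_trans _ (dual_norm_ub _ (_ : `|0| <= 1)))// normr0.
rewrite -ler_pdivlMl ?normr_gt0// -normfV.
by rewrite -{1}(scalerK a0 l) le1.
Qed.

Fact dual_norm_eq0 l : dual_norm l = 0 -> l = 0.
Proof.
move=> l0; apply: dual_ext => x; apply/eqP; rewrite -normr_le0.
by rewrite (le_trans (ler_dual_norm l x))// l0 mul0r.
Qed.

HB.instance Definition _ :=
  Lmodule_isNormed.Build R (dual S) dual_normD dual_normZ dual_norm_eq0.

End dual_norm.

Section functionals.
Context {R : realType} {S : normedModType R}.
Implicit Types F : set (dual S).

Definition linear_subspace F :=
  F 0 /\ forall (a : R) l1 l2, F l1 -> F l2 -> F (a *: l1 + l2).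

Definition separates_points F :=
  forall s t : S, s != t -> exists2 l, F l & l s != l t.

Definition weak_by F := sup_topology (fun l : set_type F =>
  Topological.class (initial_topology (val l : S -> R))).

HB.instance Definition _ F := Topological.copy (weak_by F)
  (sup_topology (fun l : set_type F =>
     Topological.class (initial_topology (val l : S -> R)))).

Lemma continuous_weak_byP (X : topologicalType) F (g : X -> S) :
  continuous (g : X -> weak_by F) <->
  forall l, F l -> continuous (fun x => l (g x) : R).
Proof.
pose Ti (l : set_type F) := initial_topology (val l : S -> R).
split=> [gc l Fl x|gc x].
  pose i : set_type F := SigSub (mem_set Fl).
  have gi : (g : X -> Ti i) @ x --> (g x : Ti i).
    have [+ _] := @cvg_sup S _ (fun l => Topological.class (Ti l)) (g @ x)
      (g x) _.
    by apply; exact: gc.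
  apply: (@cvg_comp _ _ _ (g : X -> Ti i) (val i : Ti i -> R) _ _ _ gi).
  exact: (@initial_continuous S R (val i)).
apply/cvg_sup => i.
apply: (@continuous_comp_initial S X R (val i) (g : X -> Ti i)).
by move=> y; exact: (gc _ (set_mem (valP i)) y).
Qed.

Definition continuous_into (X : topologicalType) F : set (X -> dual S) :=
  [set psi | continuous psi /\ forall x, F (psi x)].

End functionals.

Section bochner.
Context d (T : measurableType d) (R : realType) (S : normedModType R).
Variable m : {finite_measure set T -> \bar R}.

Definition simple_function (s : T -> S) :=
  finite_set (range s) /\ forall v, measurable (s @^-1` [set v]).

Definition simple_integral (A : set T) (s : T -> S) : S :=
  \sum_(v \in range s) fine (m (A `&` s @^-1` [set v])) *: v.

(* A limit f that exists only almost everywhere need not be measurable; it is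
   then equal to a measurable function outside a measurable null set, so the
   integral below and the one in vintegral still have their usual values. *)
Definition bochner_approx (f : T -> S) (s : nat -> T -> S) :=
  [/\ forall n, simple_function (s n),
      {ae m, forall w, s n w @[n --> \oo] --> f w} &
      (\int[m]_w `|f w - s n w|%:E)%E @[n --> \oo] --> 0%E].

Definition bochner_integrable (f : T -> S) := exists s, bochner_approx f s.

(* The limit does not depend on the approximating sequence. *)
Definition bochner_integral (A : set T) (f : T -> S) : S :=
  xget 0 [set v | exists2 s, bochner_approx f s &
                             simple_integral A (s n) @[n --> \oo] --> v].

End bochner.

Section vector_measures.
Context d (T : measurableType d) (R : realType) (S : normedModType R).

Definition vmeasure_rep (mu : set T -> S)
    (r : {finite_measure set T -> \bar R} * (T -> S)) :=
  bochner_integrable r.1 r.2 /\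
  forall A, measurable A -> mu A = bochner_integral r.1 A r.2.

(* As for scalar measures, the values at non-measurable sets are irrelevant. *)
Record vmeasure := VMeasure {
  vmeasure_fun :> set T -> S ;
  vmeasureP : exists r, vmeasure_rep vmeasure_fun r }.

(* vbase mu plays the role of |mu| and vdensity mu that of dmu/d|mu|: one of the
   representations of mu, on which vintegral mu psi does not depend. *)
Definition vbase (mu : vmeasure) : {finite_measure set T -> \bar R} :=
  (sval (cid (vmeasureP mu))).1.

Definition vdensity (mu : vmeasure) : T -> S :=
  (sval (cid (vmeasureP mu))).2.

Definition vintegral (mu : vmeasure) (psi : T -> dual S) : R :=
  \int[vbase mu]_w (psi w (vdensity mu w)).

End vector_measures.

Section transport.
Context {R : realType} {X Y : pointedMetricType R} {S : normedModType R}.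
Variable F : set (dual S).

Local Notation plan := {finite_measure set (borel (X * Y)%type) -> \bar R}.

Definition plans (mu : vmeasure (borel X) S) (nu : vmeasure (borel Y) S)
    (eta : X * Y -> S) : set plan :=
  [set p : plan | forall (psi : X -> dual S) (phi : Y -> dual S),
    continuous_into F psi -> continuous_into F phi ->
    vintegral mu psi + vintegral nu phi =
    \int[p]_z ((psi z.1 + phi z.2) (eta z))].

Definition potentials (c : X * Y -> R) (eta : X * Y -> S) :
    set ((X -> dual S) * (Y -> dual S)) :=
  [set q | [/\ continuous_into F q.1, continuous_into F q.2 &
     forall x y, (q.1 x + q.2 y) (eta (x, y)) <= c (x, y)]].

End transport.

(* Main.v *)
From HB Require Import structures.
Require Import Defs.
From mathcomp Require Import all_boot all_order all_algebra.
From mathcomp Require Import all_classical all_reals all_analysis.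
From mathcomp Require Import measurable_realfun ring lra.
Set Implicit Arguments.
Unset Strict Implicit.
Unset Printing Implicit Defensive.
Import Order.TTheory GRing.Theory Num.Def Num.Theory.
Import numFieldNormedType.Exports.
Local Open Scope classical_set_scope.
Local Open Scope ring_scope.

(* Weak duality is the definition of a plan applied to a pair of potentials.
   For strong duality, integration of potentials is a linear functional on the
   functions <psi(x) + phi(y), eta(x, y)>; it is positive as soon as the dual
   value D is finite, because f makes the constants available, and sending the
   cost c to D keeps it positive. By the M. Riesz extension theorem it extends
   to a positive functional, which is represented by a measure, an optimal plan.
   The representation goes through a continuous surjection from the Cantor space
   onto X * Y (Alexandroff-Hausdorff): the functional is extended to all bounded
   functions on the Cantor space, restricted to indicators of cylinder sets,
   where countable additivity is free by compactness, extended by Caratheodory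
   and pushed forward. *)

(** * Extension of positive functionals *)

Section positive_extension.
Context {R : realType} {T : Type}.
Implicit Types (g h : T -> R) (G : set ((T -> R) * R)).

(** Partial functionals are relations between functions and values. Nothing asks for a single value
    per function; linearity and positivity force it. *)
Definition graph_linear G := forall a g r h s,
  G (g, r) -> G (h, s) -> G (fun x => a * g x + h x, a * r + s).

Definition graph_positive G := forall g r,
  G (g, r) -> (forall x, 0 <= g x) -> 0 <= r.

Lemma graph_monotone G g r h s : graph_linear G -> graph_positive G ->
  G (g, r) -> G (h, s) -> (forall x, g x <= h x) -> r <= s.
Proof.
move=> Gl Gp Gg Gh gh.
have := Gl (-1) _ _ _ _ Gg Gh; move=> /Gp H.
by rewrite -subr_ge0 addrC -mulN1r H// => x; rewrite mulN1r addrC subr_ge0.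
Qed.

Lemma graph_functional G g r s : graph_linear G -> graph_positive G ->
  G (g, r) -> G (g, s) -> r = s.
Proof.
by move=> Gl Gp Gr Gs; apply/eqP; rewrite eq_le;
  apply/andP; split; apply: (graph_monotone Gl Gp); eassumption || by [].
Qed.

(** A positive extension must give [g] at least each of these values. For the pairings and the cost
    [c] they are the dual values. *)
Definition graph_below G g :=
  [set s | exists2 h, G (h, s) & forall x, h x <= g x].

(** The new graph lives on the functions [h + t * g0]. After division by [t], positivity says that
    minorants of [g0] have values at most the supremum ([t > 0]) and majorants at least it
    ([t < 0]). The functions [h1] and [h2] make the supremum a genuine one. *)
Lemma graph_extend1 G g0 h1 s1 h2 s2 : graph_linear G -> graph_positive G ->
    G (h1, s1) -> (forall x, h1 x <= g0 x) ->
    G (h2, s2) -> (forall x, g0 x <= h2 x) ->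
  exists G', [/\ graph_linear G', graph_positive G', G `<=` G' &
    G' (g0, sup (graph_below G g0))].
Proof.
move=> Gl Gp G1 h1g G2 h2g; set A := graph_below G g0.
have A0 : A s1 by exists h1.
have Aub h s : G (h, s) -> (forall x, g0 x <= h x) -> ubound A s.
  move=> Gh gh u [k Gk kg]; apply: (graph_monotone Gl Gp Gk Gh) => x.
  exact: le_trans (kg x) (gh x).
have Asup : has_sup A.
  by split; [exists s1|exists s2; exact: Aub G2 h2g].
have G0 : G (fun=> 0, 0).
  have := Gl (-1) _ _ _ _ G1 G1.
  by congr G; congr pair; [apply/funext => x|]; ring.
have GZ a h s : G (h, s) -> G (fun x => a * h x, a * s).
  move=> Gh; have := Gl a _ _ _ _ Gh G0.
  by congr G; congr pair; [apply/funext => x|]; ring.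
exists [set p | exists t h s, G (h, s) /\
  p = (fun x => h x + t * g0 x, s + t * sup A)]; split.
- move=> a _ r _ s [t [h [u [Gh [-> ->]]]]] [t' [h' [u' [Gh' [-> ->]]]]].
  exists (a * t + t'), (fun x => a * h x + h' x), (a * u + u').
  split; first exact: Gl.
  by congr pair; [apply/funext => x|]; ring.
- move=> _ r [t [h [u [Gh [-> ->]]]]] pos.
  have [t0|t0|t0] := ltgtP t 0; last first.
  + rewrite t0 mul0r addr0; apply: Gp Gh _ => x.
    by have := pos x; rewrite t0 mul0r addr0.
  + have : A (- t^-1 * u).
      exists (fun x => - t^-1 * h x); first exact: GZ.
      move=> x; have := pos x => H.
      rewrite -subr_ge0 (_ : _ - _ = t^-1 * (h x + t * g0 x)).
        by rewrite mulr_ge0// invr_ge0 ltW.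
      by field; rewrite gt_eqF.
    move=> /(sup_upper_bound Asup) H.
    have : 0 <= t * (sup A + t^-1 * u) by rewrite mulr_ge0 ?(ltW t0)//; lra.
    by rewrite mulrDr mulVKf ?gt_eqF// addrC.
  + have : ubound A (- t^-1 * u).
      apply: (Aub (fun x => - t^-1 * h x)); first exact: GZ.
      move=> x; have := pos x => H.
      rewrite -subr_ge0 (_ : _ - _ = (- t^-1) * (h x + t * g0 x)).
        by rewrite mulr_ge0// oppr_ge0 invr_le0 ltW.
      by field; rewrite lt_eqF.
    move=> /(ge_sup _) H; have {}H : sup A <= - t^-1 * u by apply: H; exists s1.
    have : 0 <= (- t) * ((- t^-1 * u) - sup A).
      by rewrite mulr_ge0 ?oppr_ge0 ?(ltW t0)// subr_ge0.
    by rewrite mulrBr !mulNr mulrN opprK opprK mulVKf ?lt_eqF.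
- move=> -[h s] Gh; exists 0, h, s; split => //.
  by congr pair; [apply/funext => x|]; ring.
- exists 1, (fun=> 0), 0; split => //; rewrite mul1r add0r; congr pair.
  by apply/funext => x; rewrite mul1r add0r.
Qed.

Definition fbounded g := exists M, forall x, `|g x| <= M.

Lemma fbounded_lin a g h : fbounded g -> fbounded h ->
  fbounded (fun x => a * g x + h x).
Proof.
move=> [M gM] [N hN]; exists (`|a| * M + N) => x.
by rewrite (le_trans (ler_normD _ _))// lerD// normrM ler_wpM2l.
Qed.

(** A nonnegative [g] of negative value could be subtracted with any factor from a constant minorant
    of [c], which would give minorants of unbounded value. *)
Lemma graph_positive_of_ubound G r1 c D : graph_linear G ->
  G (fun=> 1, r1) -> fbounded c -> ubound (graph_below G c) D ->
  graph_positive G.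
Proof.
move=> Gl G1 [C cC] GD g r Gg g0; rewrite leNgt; apply/negP => r0.
(* With this factor the minorant [- e * g - C] has value [|D + C * r1| + 1 - C * r1], which exceeds
   [D]. To fit [graph_linear], [- C] is written [- (C + 1) * 1 + 1]. *)
pose e := (`|D + C * r1| + 1) / - r.
have e0 : 0 <= e by rewrite divr_ge0 ?addr_ge0// oppr_ge0 ltW.
have GC := Gl (- (C + 1)) _ _ _ _ G1 G1.
have : D >= - e * r + (- (C + 1) * r1 + r1).
  apply: GD; exists (fun x => - e * g x + (- (C + 1) * 1 + 1)); first exact: Gl.
  move=> x; have := cC x; rewrite ler_norml => /andP[+ _]; apply: le_trans.
  by have := mulr_ge0 e0 (g0 x); lra.
have -> : - e * r = `|D + C * r1| + 1 by rewrite /e; field; rewrite lt_eqF.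
have := ler_norm (D + C * r1); lra.
Qed.

Lemma fbounded_indic (A : set T) : fbounded (\1_A : T -> R).
Proof.
by exists 1 => x; rewrite indicE ger0_norm ?ler0n// lern1 leq_b1.
Qed.

Lemma fbounded_cst (a : R) : fbounded (fun=> a).
Proof. by exists `|a|. Qed.

(* The Zorn step runs over graphs rather than functionals, so that a chain is
   dominated by its union. *)
Lemma positive_extension G r1 : graph_linear G -> graph_positive G ->
    G (fun=> 1, r1) ->
  exists L : (T -> R) -> R,
    [/\ forall a g h, fbounded g -> fbounded h ->
          L (fun x => a * g x + h x) = a * L g + L h,
        forall g, fbounded g -> (forall x, 0 <= g x) -> 0 <= L g &
        forall g r, G (g, r) -> L g = r].
Proof.
move=> Gl Gp G1.
(* The property concerns the union with [G], so that the empty chain is dominated too. *)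
pose P H := graph_linear (H `|` G) /\ graph_positive (H `|` G).
have [F FP Ft|H [[Hl Hp] Hmax]] := @Zorn_bigcup _ P.
  have UF p q : (\bigcup_(X in F) X `|` G) p -> (\bigcup_(X in F) X `|` G) q ->
      (G p /\ G q) \/ exists2 X, F X & (X `|` G) p /\ (X `|` G) q.
    move=> [[X FX Xp]|Gp'] [[Y FY Yq]|Gq']; last by left.
    - right; have [XY|YX] := Ft _ _ FX FY.
        by exists Y => //; split; left => //; exact: XY.
      by exists X => //; split; left => //; exact: YX.
    - by right; exists X => //; split; [left|right].
    - by right; exists Y => //; split; [right|left].
  split.
    move=> a g r h s Ug Uh; have [[Gg Gh]|[X FX [Xg Xh]]] := UF _ _ Ug Uh.
      by right; exact: Gl.
    have [Xl _] := FP _ FX.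
    by have [XX|GG] := Xl a _ _ _ _ Xg Xh; [left; exists X|right].
  move=> g r Ug; have [[Gg _]|[X FX [Xg _]]] := UF _ _ Ug Ug; first exact: Gp.
  by have [_] := FP _ FX; apply.
set K := H `|` G in Hl Hp.
have K1 : K (fun=> 1, r1) by right.
have KZ a : K (fun=> a, a * r1).
  have := Hl (a - 1) _ _ _ _ K1 K1.
  by congr K; congr pair; [apply/funext => x|]; ring.
(* A bounded [g] lies between two constants, so a maximal graph without a value at [g] could be
   enlarged. *)
have dom g : fbounded g -> exists r, K (g, r).
  move=> [M gM]; apply: contrapT => nK.
  have gub x : g x <= M by rewrite (le_trans (ler_norm _)).
  have glb x : - M <= g x by rewrite lerNl (le_trans (ler_norm _))// normrN.
  have [K' [K'l K'p KK' K'g]] := graph_extend1 Hl Hp (KZ (- M)) glb (KZ M) gub.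
  have K'G : K' `|` G = K'.
    by rewrite setUidl// => p Gp'; apply: KK'; right.
  apply: (Hmax K'); last by rewrite /P K'G.
  split; first by move=> p Hp'; apply: KK'; left.
  by move=> /(_ _ K'g) H'; apply: nK; eexists; left; exact: H'.
(* The default 0 is used only outside the domain of [K], hence at no bounded function. *)
pose L g := xget 0 [set r | K (g, r)].
have LK g r : K (g, r) -> L g = r.
  move=> Kg; apply: (@graph_functional K g) => //.
  by rewrite /L; case: xgetP => [y _ //|/(_ r)].
exists L; split.
- move=> a g h /dom[r Kr] /dom[s Ks].
  by rewrite (LK _ _ Kr) (LK _ _ Ks); apply: LK; exact: Hl.
- by move=> g /dom[r Kr] g0; rewrite (LK _ _ Kr); exact: Hp Kr g0.
- by move=> g r Gg; apply: LK; right.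
Qed.

End positive_extension.

(** * Positive functionals on the Cantor space *)

Section cantor_cylinders.
Implicit Types (x y : cantor_space) (A : set cantor_space).

Definition agree n x y := forall i, (i < n)%N -> x i = y i.

Definition prefix_determined n A := forall x y, agree n x y -> A x -> A y.

Lemma agree_sym n x y : agree n x y -> agree n y x.
Proof. by move=> xy i /xy. Qed.

Lemma agree_trans n x y z : agree n x y -> agree n y z -> agree n x z.
Proof. by move=> xy yz i ni; rewrite xy// yz. Qed.

Lemma agree_le m n x y : (m <= n)%N -> agree n x y -> agree m x y.
Proof. by move=> mn xy i im; apply: xy; exact: leq_trans im mn. Qed.

Lemma nbhs_agree n x : nbhs x (agree n x).
Proof.
elim: n => [|n IHn]; first by apply: filterS filterT => y _ i.
have : nbhs x [set y : cantor_space | y n = x n].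
  have /(_ x) := @proj_continuous nat (fun=> bool) n.
  move=> /(_ [set x n]); apply.
  by apply: open_nbhs_nbhs; split => //; exact: discrete_open.
apply: filterS2 IHn => y xy yx i; rewrite ltnS leq_eqVlt => /predU1P[->//|].
exact: xy.
Qed.

(** The sets [agree n x] generate a filter that converges in every coordinate, hence in the product
    topology. *)
Lemma nbhs_agreeP x A : nbhs x A -> exists n, agree n x `<=` A.
Proof.
pose F := filter_from [set: nat] (fun n => agree n x).
have FF : Filter F.
  apply: filter_from_filter; first by exists 0%N.
  move=> m n _ _; exists (maxn m n) => // y xy.
  by split; apply: agree_le xy; rewrite ?leq_maxl ?leq_maxr.
have Fx : F --> x.
  apply/cvg_sup => i U /=.
  rewrite (@nbhsE (initial_topology (fun f : cantor_space => f i))).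
  move=> -[V [[W oW <-] Vx] VU].
  (* Agreement below [i.+1] includes the coordinate [i]. *)
  exists i.+1 => // y xy; apply: VU.
  by rewrite /preimage/= -xy.
by move=> /Fx [n _ ?]; exists n.
Qed.

(** Cantor's intersection theorem: a cluster point of points chosen in the sets lies in all of them,
    because a set determined by a prefix is closed. *)
Lemma prefix_determined_cap (A : nat -> set cantor_space) :
  (forall n, A n !=set0) -> (forall n, A n.+1 `<=` A n) ->
  (forall n, exists k, prefix_determined k (A n)) -> \bigcap_n A n !=set0.
Proof.
move=> A0 AS Ad; pose u n := sval (cid (A0 n)).
have uA n : A n (u n) := svalP (cid (A0 n)).
have Ale m n : (m <= n)%N -> A n `<=` A m.
  move=> /subnK <-; elim: (n - m)%N => // k IHk.
  by rewrite addSn; exact: subset_trans (AS _) IHk.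
have [x [_ ux]] := @cantor_space_compact (u @ \oo) _ filterT.
exists x => n _; have [k Ak] := Ad n.
have [|y [Any xy]] := ux (A n) (agree k x) _ (nbhs_agree k x).
  by exists n => // m /= nm; apply: Ale nm _ _.
by apply: Ak Any; exact: agree_sym.
Qed.

(** If no [n] worked, the points near which [g] varies by at least [e] within an [n]-cylinder would
    form nested nonempty cylinder sets, and [g] would be discontinuous at a common point. *)
Lemma agree_uniformly_continuous (R : realType) (g : cantor_space -> R) e :
  continuous g -> 0 < e ->
  exists n, forall x y, agree n x y -> `|g x - g y| < e.
Proof.
move=> gc e0; apply: contrapT => H.
pose A n := [set x | exists y z, [/\ agree n x y, agree n x z &
                                   e <= `|g y - g z|]].
have [|n x [y [z [xy xz yz]]]|n|x Ax] := @prefix_determined_cap A.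
- move=> n; apply: contrapT => An; apply: H; exists n => x y xy.
  by rewrite ltNge; apply/negP => exy; apply: An; exists x, x, y.
- by exists y, z; split=> //; apply: agree_le (leqnSn _) _.
- exists n => x x' xx' [y [z [xy xz yz]]]; exists y, z; split=> //.
    exact: agree_trans (agree_sym xx') xy.
  exact: agree_trans (agree_sym xx') xz.
have /gc : nbhs (g x) (ball (g x) (e / 2)) by apply: nbhsx_ballx; rewrite divr_gt0.
move=> /nbhs_agreeP[n xn].
have [y [z [xy xz]]] := Ax n I; rewrite leNgt => /negP; apply.
have := xn _ xy; have := xn _ xz; rewrite /ball /= => gz gy.
rewrite (_ : g y - g z = (g x - g z) - (g x - g y)); last by ring.
by rewrite (le_lt_trans (ler_normB _ _))// (splitr e) ltrD.
Qed.

End cantor_cylinders.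

(** * The algebra of cylinder sets *)

Definition cylinder_space := cantor_space.
HB.instance Definition _ := Pointed.on cylinder_space.

Section cylinder_algebra.

Definition cylinder_sets : set (set cylinder_space) :=
  [set A | exists n, prefix_determined n A].

Lemma cylinder_sets0 : cylinder_sets set0.
Proof. by exists 0%N. Qed.

Lemma cylinder_setsU : setU_closed cylinder_sets.
Proof.
move=> A B [m Am] [n Bn]; exists (maxn m n) => x y xy [Ax|Bx].
- by left; apply: Am Ax; exact: agree_le (leq_maxl _ _) xy.
- by right; apply: Bn Bx; exact: agree_le (leq_maxr _ _) xy.
Qed.

Lemma cylinder_setsC : setC_closed cylinder_sets.
Proof.
by move=> A [n An]; exists n => x y xy Ax Ay; apply: Ax; apply: An Ay; exact: agree_sym.
Qed.

HB.instance Definition _ := @isAlgebraOfSets.Build default_measure_display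
  cylinder_space cylinder_sets cylinder_sets0 cylinder_setsU cylinder_setsC.

End cylinder_algebra.

(** * Integrability of bounded functions and measurability of continuous ones *)

Lemma fbounded_integrable d (T : measurableType d) (R : realType)
    (m : {finite_measure set T -> \bar R}) (g : T -> R) :
  measurable_fun setT g -> fbounded g -> m.-integrable setT (EFin \o g).
Proof.
move=> mg [M gM]; apply: measurable_bounded_integrable => //.
  by rewrite ltey_eq fin_num_measure.
by exists M; split; rewrite ?num_real// => N /ltW MN x _; exact: le_trans MN.
Qed.

Lemma Rintegral_lin d (T : measurableType d) (R : realType)
    (m : {measure set T -> \bar R}) a (g h : T -> R) :
  m.-integrable setT (EFin \o g) -> m.-integrable setT (EFin \o h) ->
  \int[m]_x (a * g x + h x) = a * \int[m]_x g x + \int[m]_x h x.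
Proof.
move=> ig ih; rewrite RintegralD ?RintegralZl//.
exact: (integrableZl _ _ ig).
Qed.

Lemma measurable_fun_opens d (T : measurableType d) (R : realType)
    (g : T -> R) : (forall U : set R, open U -> measurable (g @^-1` U)) ->
  measurable_fun setT g.
Proof.
move=> mg; apply: (measurability _ (RGenOpens.measurableE R)) => //.
by move=> _ [_ [a [b ->] <-]]; rewrite setTI; apply: mg; exact: interval_open.
Qed.

Lemma continuous_borel_measurable (R : realType) (T : ptopologicalType)
    (g : T -> R) : continuous g -> measurable_fun setT (g : borel T -> R).
Proof.
move=> /continuousP gc; apply: measurable_fun_opens => U oU.
by apply: sub_gen_smallest; exact: gc.
Qed.

Lemma compact_continuous_fbounded (R : realType) (T : topologicalType)
    (g : T -> R) : compact [set: T] -> continuous g -> fbounded g.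
Proof.
move=> cT gc; have : compact (range g).
  by apply: continuous_compact cT; exact: continuous_subspaceT.
move=> /compact_bounded[M [_ gM]]; exists (M + 1) => x.
by apply: gM => //; rewrite ltrDl.
Qed.

(** * The measure that represents a positive functional on the Cantor space *)

Section cylinder_measure.
Context {R : realType} (L : (cantor_space -> R) -> R).
Hypothesis L_lin : forall a g h, fbounded g -> fbounded h ->
  L (fun x => a * g x + h x) = a * L g + L h.
Hypothesis L_ge0 : forall g, fbounded g -> (forall x, 0 <= g x) -> 0 <= L g.

Let L_le g h : fbounded g -> fbounded h -> (forall x, g x <= h x) -> L g <= L h.
Proof.
move=> bg bh gh; have := L_ge0 (fbounded_lin (-1) bg bh).
rewrite L_lin// mulN1r addrC subr_ge0; apply => x.
by rewrite mulN1r addrC subr_ge0.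
Qed.

Let L0 : L (fun=> 0) = 0.
Proof.
have b0 := fbounded_cst (T := cantor_space) (0 : R).
by have := L_lin 1 b0 b0; under eq_fun do rewrite mulr0 addr0; lra.
Qed.

(** Indicators need not come from functions on the original compact space; this is why [L] is taken
    linear and positive on all bounded functions. *)
Definition cylinder_content (A : set cylinder_space) : \bar R := (L \1_A)%:E.

Let cylinder_content_ge0 A : (0 <= cylinder_content A)%E.
Proof. by rewrite lee_fin L_ge0//; exact: fbounded_indic. Qed.

Let cylinder_content_additive : measure_function.semi_additive cylinder_content.
Proof.
apply/additive2P; rewrite /cylinder_content.
  by rewrite indic0 L0.
move=> A B _ _ AB.
rewrite -EFinD -[X in (X + _)%R]mul1r -L_lin; [|exact: fbounded_indic..].
congr EFin; congr L; apply/funext => x; rewrite !indicE mul1r in_setU -natrD.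
have [xA|] := boolP (x \in A); have [xB|] //= := boolP (x \in B).
by have : (A `&` B) x; [split; exact: set_mem|rewrite AB].
Qed.

HB.instance Definition _ := isContent.Build _ cylinder_space R cylinder_content
  cylinder_content_ge0 cylinder_content_additive.

(* A disjoint sequence of cylinder sets with a cylinder set as union has only
   finitely many nonempty members, by compactness. *)
Let cylinder_content_sigma_additive : semi_sigma_additive cylinder_content.
Proof.
move=> F mF tF mUF.
(* The remainders [A n] are nested cylinder sets. A common point would lie in some [F i], which
   [A i.+1] excludes; so some remainder is empty. *)
pose A n := \bigcup_i F i `\` \big[setU/set0]_(i < n) F i.
have [N AN] : exists N, A N = set0.
  apply: contrapT => /forallNP A0.
  have [|||x Ax] := @prefix_determined_cap A.
  - by move=> n; apply/set0P/eqP.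
  - move=> n x [Ux nx]; split=> // Fx; apply: nx.
    by rewrite big_ord_recr; left.
  - move=> n; suff : measurable (A n) by [].
    by apply: measurableD => //; apply: bigsetU_measurable.
  have [[i _ Fix] _] := Ax 0%N I.
  have [_ []] := Ax i.+1 I.
  by rewrite big_ord_recr; right.
have UE n : (N <= n)%N -> \big[setU/set0]_(i < n) F i = \bigcup_i F i.
  move=> Nn; apply/seteqP; split=> x.
    by rewrite -bigcup_mkord => -[i _ Fx]; exists i.
  move=> Ux; rewrite -bigcup_mkord.
  have : (\big[setU/set0]_(i < N) F i) x.
    by apply: contrapT => nx; have : A N x by []; rewrite AN.
  by rewrite -bigcup_mkord => -[i /= iN Fx]; exists i => //=; exact: leq_trans Nn.
apply: cvg_near_cst; exists N => // n /= Nn.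
rewrite big_mkord -(UE n Nn) -measure_semi_additive//.
by rewrite UE.
Qed.

HB.instance Definition _ := Content_isMeasure.Build _ cylinder_space R
  cylinder_content cylinder_content_sigma_additive.

Local Notation sigma_cylinder := (g_sigma_algebraType cylinder_sets).

Definition cylinder_measure : set sigma_cylinder -> \bar R :=
  measure_extension cylinder_content.

HB.instance Definition _ := Measure.on cylinder_measure.

Let cylinder_measureE A : cylinder_sets A -> cylinder_measure A = (L \1_A)%:E.
Proof.
by move=> mA; rewrite /cylinder_measure/measure_extension measurable_mu_extE.
Qed.

Let cylinder_measure_fin : fin_num_fun cylinder_measure.
Proof.
suff : (cylinder_measure setT < +oo)%E by exact: lty_fin_num_fun.
by rewrite cylinder_measureE ?ltry//; exists 0%N.
Qed.

HB.instance Definition _ := Measure_isFinite.Build _ _ _ cylinder_measure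
  cylinder_measure_fin.

(** This class contains the indicators of cylinder sets and is closed under linear combinations, so
    it reaches all functions of finitely many coordinates. Boundedness and measurability are carried
    along to keep the integral linear. *)
Let preserves (h : cantor_space -> R) :=
  [/\ fbounded h, measurable_fun setT (h : sigma_cylinder -> R) &
      \int[cylinder_measure]_x h x = L h].

Let preserves_lin a g h : preserves g -> preserves h ->
  preserves (fun x => a * g x + h x).
Proof.
move=> [bg mg ig] [bh mh ih]; split; first exact: fbounded_lin.
  by apply: measurable_funD => //; exact: measurable_funM.
by rewrite L_lin// Rintegral_lin ?ig ?ih//; exact: fbounded_integrable.
Qed.

Let preserves_indic A : cylinder_sets A -> preserves \1_A.
Proof.
move=> mA; have mA' : measurable (A : set sigma_cylinder).
  exact: sub_gen_smallest.
split; first exact: fbounded_indic; first exact: measurable_indic.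
rewrite /Rintegral integral_indic// setIT.
exact: (congr1 fine (cylinder_measureE mA)).
Qed.

(** Such an [h] is the finite sum, over the prefixes of length [n], of its value on the cylinder
    times the indicator of the cylinder. *)
Let preserves_prefix n (h : cantor_space -> R) :
  (forall x y, agree n x y -> h x = h y) -> preserves h.
Proof.
move=> hn.
pose ext (v : {ffun 'I_n -> bool}) : cantor_space :=
  fun i => if insub i is Some j then v j else false.
have extE (v : {ffun 'I_n -> bool}) (j : 'I_n) : ext v j = v j.
  by rewrite /ext valK.
have -> : h = fun x => \sum_(v : {ffun 'I_n -> bool})
    h (ext v) * \1_(agree n (ext v)) x.
  apply/funext => x; pose v := [ffun i : 'I_n => x i].
  have xv : agree n (ext v) x.
    by move=> i ni; rewrite (extE v (Ordinal ni)) ffunE.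
  rewrite (bigD1 v)//= big1 ?addr0 => [|w wv].
    by rewrite indicE mem_set// mulr1; exact/hn/agree_sym.
  rewrite indicE memNset ?mulr0// => xw.
  move/eqP: wv; apply; apply/ffunP => i.
  by rewrite ffunE -extE xw.
elim: (index_enum _) => [|v s IHs].
  under eq_fun do rewrite big_nil.
  have := preserves_indic (@cylinder_sets0); rewrite indic0; exact.
under eq_fun do rewrite big_cons.
apply: preserves_lin => //; apply: preserves_indic.
by exists n => x y xy vx; exact: agree_trans xy.
Qed.

(** An open set is the countable union, over [n], of the cylinder sets of points whose whole
    [n]-cylinder it contains. *)
Lemma measurable_open_cantor (U : set cantor_space) : open U ->
  measurable (U : set sigma_cylinder).
Proof.
move=> oU; have -> : U = \bigcup_n [set x | agree n x `<=` U].
  apply/seteqP; split=> x; last by move=> [n _ xU]; apply: xU.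
  move=> Ux; have [n xn] := nbhs_agreeP (open_nbhs_nbhs (conj oU Ux)).
  by exists n.
apply: bigcup_measurable => n _; apply: sub_gen_smallest; exists n => x y xy xU.
by move=> z yz; apply: xU; exact: agree_trans yz.
Qed.

Lemma continuous_cantor_measurable (g : cantor_space -> R) : continuous g ->
  measurable_fun setT (g : sigma_cylinder -> R).
Proof.
move=> /continuousP gc; apply: measurable_fun_opens => U oU.
by apply: measurable_open_cantor; exact: gc.
Qed.

(** By uniform continuity [g] is uniformly close to a function of finitely many coordinates, and
    both sides are monotone. *)
Let integral_cylinder_measure (g : cantor_space -> R) : continuous g ->
  \int[cylinder_measure]_x g x = L g.
Proof.
move=> gc; have bg := compact_continuous_fbounded cantor_space_compact gc.
have mg := continuous_cantor_measurable gc.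
have b1 := fbounded_cst (T := cantor_space) (1 : R).
have [_ m1 i1] : preserves (fun=> 1) by exact: (@preserves_prefix 0%N).
apply/eqP; rewrite -subr_eq0 -normr_le0; apply/ler_addgt0Pl => e e0.
rewrite addr0.
(* The integral and [L] each contribute an error of at most [d * L 1], and the total must not exceed
   [e]; the added 1 covers the case [L 1 = 0]. *)
pose d := e / (2 * (L (fun=> 1) + 1)).
have L1 : 0 <= L (fun=> 1) by exact: L_ge0.
have d0 : 0 < d by rewrite divr_gt0// mulr_gt0// ltr_wpDl.
have [n gn] := agree_uniformly_continuous gc d0.
pose h x := g (fun i => if (i < n)%N then x i else false).
have gh x : `|g x - h x| < d by apply: gn => i ->.
have [bh mh ih] : preserves h.
  apply: (@preserves_prefix n) => x y xy; congr g; apply/funext => i.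
  by case: ifPn => // /xy.
have gdh x : g x <= d * 1 + h x.
  by have := gh x; rewrite ltr_norml mulr1 => /andP[_]; lra.
have hdg x : h x <= d * 1 + g x.
  by have := gh x; rewrite ltr_norml mulr1 => /andP[+ _]; lra.
have Lgh : L g <= d * L (fun=> 1) + L h.
  by rewrite -L_lin//; apply: L_le => //; exact: fbounded_lin.
have Lhg : L h <= d * L (fun=> 1) + L g.
  by rewrite -L_lin//; apply: L_le => //; exact: fbounded_lin.
have mlin k : measurable_fun setT (k : sigma_cylinder -> R) ->
    measurable_fun setT ((fun x => d * 1 + k x) : sigma_cylinder -> R).
  by move=> mk; apply: measurable_funD.
have Igh : \int[cylinder_measure]_x g x <= d * L (fun=> 1) + L h.
  rewrite -i1 -ih -Rintegral_lin; [|exact: fbounded_integrable..].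
  apply: le_Rintegral => //; apply: fbounded_integrable => //; first exact: mlin.
  exact: fbounded_lin.
have Ihg : L h <= d * L (fun=> 1) + \int[cylinder_measure]_x g x.
  rewrite -i1 -ih -Rintegral_lin; [|exact: fbounded_integrable..].
  apply: le_Rintegral => //; apply: fbounded_integrable => //; first exact: mlin.
  exact: fbounded_lin.
have : 2 * (d * L (fun=> 1)) <= e.
  rewrite (_ : 2 * _ = e * (L (fun=> 1) / (L (fun=> 1) + 1))).
    by rewrite ler_piMr ?(ltW e0)// ler_pdivrMr ?ltr_wpDl// mul1r lerDl.
  by rewrite /d; field; rewrite gt_eqF ?ltr_wpDl.
rewrite ler_norml; lra.
Qed.

Lemma cantor_positive_measure :
  exists m : {finite_measure set sigma_cylinder -> \bar R},
    forall g, continuous g -> \int[m]_x g x = L g.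
Proof. by exists cylinder_measure; exact: integral_cylinder_measure. Qed.

End cylinder_measure.

(** * Positive functionals on compact metric spaces *)

(** Meant for a pushforward, which comes bundled as a measure only, whereas plans are bundled finite
    measures. *)
Lemma finite_measure_of d (T : measurableType d) (R : realType)
    (m : {measure set T -> \bar R}) : fin_num_fun m ->
  exists p : {finite_measure set T -> \bar R}, p = m :> {measure set T -> \bar R}.
Proof.
move=> mfin.
have msig : sigma_finite setT m.
  by apply: fin_num_fun_sigma_finite => //; rewrite measure0.
pose H1 := isFinite.Build _ _ _ _ mfin.
pose H2 := isSFinite.Build _ _ _ _ (sfinite_measure_sigma_finite msig).
pose H3 := isSigmaFinite.Build _ _ _ _ msig.
pose p := HB.pack_for (FiniteMeasure.type T R) (Measure.sort m) H1 H2 H3.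
by exists p; exact: eq_measure.
Qed.

(** The graph is pulled back along a continuous map [s] from the Cantor space onto [K]. Surjectivity
    keeps it positive: [g] is nonnegative as soon as [g \o s] is. The measure that represents an
    extension is then pushed forward by [s]. *)
Lemma positive_graph_measure (R : realType) (K : pseudoPMetricType R)
    (G : set ((K -> R) * R)) (r1 : R) :
  compact [set: K] -> hausdorff_space K ->
  graph_linear G -> graph_positive G -> G (fun=> 1, r1) ->
  exists p : {finite_measure set (borel K) -> \bar R},
    forall g r, continuous g -> G (g, r) -> \int[p]_x g x = r.
Proof.
move=> cK hK Gl Gp G1.
have [s sc ssurj] : exists2 s : cantor_space -> K,
    continuous s & forall x, exists y, s y = x.
  have [s sc] := cantor_surj cK hK; exists s => // x.
  by have /(_ x I)[y _ <-] := @surj _ _ _ _ s; exists y.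
pose Gs := [set (gr.1 \o s, gr.2) | gr in G].
have Gsl : graph_linear Gs.
  move=> a _ _ _ _ [[g r] Gg [<- <-]] [[h t] Gh [<- <-]].
  by exists (fun x => a * g x + h x, a * r + t) => //; exact: Gl.
have Gsp : graph_positive Gs.
  move=> _ _ [[g r] Gg [<- <-]] /= g0; apply: Gp Gg _ => x.
  have [y <-] := ssurj x.
  exact: g0.
have [|L [Ll L0 LG]] := positive_extension Gsl Gsp (_ : Gs (fun=> 1, r1)).
  by exists (fun=> 1, r1).
have [m mE] := cantor_positive_measure Ll L0.
have ms : @measurable_fun _ _ (g_sigma_algebraType cylinder_sets) (borel K)
    setT s.
  apply: (@measurability _ _ (g_sigma_algebraType cylinder_sets) (borel K)
    setT s (@open K)); first by [].
  move=> _ [U oU <-].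
  by rewrite setTI; apply: measurable_open_cantor; move/continuousP : sc; exact.
have [|p pE] := finite_measure_of
    (m := measure_function_pushforward__canonical__measure_function_Measure m ms).
  by move=> A mA; apply: fin_num_measure; rewrite -[X in measurable X]setTI; exact: ms.
exists p => g r gc Gg; rewrite pE.
have gsc : continuous (g \o s).
  by move=> x; apply: continuous_comp; [exact: sc|exact: gc].
rewrite -(LG (g \o s) r); last by exists (g, r).
rewrite -mE// /Rintegral integral_pushforward//.
- by apply/measurable_EFinP; exact: continuous_borel_measurable.
- apply: fbounded_integrable; first exact: continuous_cantor_measurable.
  exact: (compact_continuous_fbounded cantor_space_compact gsc).
Qed.

(** * Integration against vector measures *)

Section unmeasurable_integral.
Context d (T : measurableType d) (R : realType).
Variable m : {measure set T -> \bar R}.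
Implicit Types f g : T -> \bar R.
Local Open Scope ereal_scope.

Import HBNNSimple.

(* Here f and g need not be measurable: in vintegral, the function
   psi x (vdensity mu x) is only almost everywhere equal to a measurable one. *)
Lemma ge0_le_integral_ae f g : (forall x, 0 <= f x) -> (forall x, 0 <= g x) ->
  (\forall x \ae m, f x <= g x) -> \int[m]_x f x <= \int[m]_x g x.
Proof.
move=> f0 g0 [N [mN N0 fgN]].
have mNC : measurable (~` N) by exact: measurableC.
rewrite !ge0_integralTE//; apply: ge_ereal_sup => _ [h hf <-].
(* The integral is a supremum over simple functions below the integrand. Restricting such an [h] to
   the complement of [N] puts it below [g] everywhere and keeps its integral. *)
apply: ereal_sup_ubound; exists (proj_nnsfun h mNC) => [x|].
  rewrite /= mindicE; have [xN|xN] := boolP (x \in ~` N); last by rewrite mulr0.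
  rewrite mulr1; apply: le_trans (hf x) _.
  by apply: contrapT => nfg; move/set_mem: xN; apply; exact: fgN.
rewrite -!integralT_nnsfun; apply: ae_eq_integral => //.
- exact/measurable_EFinP.
- exact/measurable_EFinP.
exists N; split=> // x /= hx; apply: contrapT => nN; apply: hx => _.
by rewrite mindicE mem_set ?mulr1.
Qed.

Lemma integral_ae_congr f g : (\forall x \ae m, f x = g x) ->
  \int[m]_x f x = \int[m]_x g x.
Proof.
move=> fg; rewrite integralE [RHS]integralE.
congr (_ - _); apply/eqP; rewrite eq_le; apply/andP; split;
  apply: ge0_le_integral_ae => //;
  by apply: filterS fg => x xx; rewrite ?funeposE ?funenegE xx.
Qed.

End unmeasurable_integral.

Lemma simple_function_comp_measurable d (T : measurableType d) (R : realType)
    (S : normedModType R) (s : T -> S) (h : T -> S -> R) :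
  simple_function s -> (forall v, measurable_fun setT (h ^~ v)) ->
  measurable_fun setT (fun w => h w (s w)).
Proof.
move=> [fs ms] mh _ B mB; rewrite setTI.
have -> : (fun w => h w (s w)) @^-1` B =
    \bigcup_(v in range s) (s @^-1` [set v] `&` (h ^~ v) @^-1` B).
  apply/seteqP; split=> w /=; first by exists (s w) => //; exists w.
  by move=> [v _ [/= -> ]].
apply: fin_bigcup_measurable => // v _; apply: measurableI => //.
by rewrite -[X in measurable X]setTI; exact: mh.
Qed.

Section vintegral_linear.
Context {R : realType} {X : pointedMetricType R} {S : normedModType R}.
Hypothesis compactX : compact [set: X].

Lemma dual_eval_continuous (psi : X -> dual S) v : continuous psi ->
  continuous (fun x => psi x v : R).
Proof.
move=> psic x; apply/cvgrPdist_le => e e0.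
have d0 : 0 < e / (`|v| + 1) by rewrite divr_gt0// ltr_wpDl.
move/cvgrPdist_le : (psic x) => /(_ _ d0); apply: filterS => y xy.
rewrite (_ : psi x v - psi y v = (psi x - psi y) v)//.
apply: le_trans (ler_dual_norm _ _) _.
apply: (@le_trans _ _ (e / (`|v| + 1) * (`|v| + 1))).
  by apply: ler_pM => //; [exact: (normr_ge0 (psi x - psi y))|rewrite lerDl].
by rewrite divfK// gt_eqF// ltr_wpDl.
Qed.

Lemma dual_bounded (psi : X -> dual S) : continuous psi ->
  exists2 M, 0 < M & forall x v, `|psi x v| <= M * `|v|.
Proof.
move=> psic; have : compact (range psi).
  by apply: continuous_compact compactX; exact: continuous_subspaceT.
move=> /compact_bounded[M [_ gM]]; exists (`|M| + 1); first by rewrite ltr_wpDl.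
move=> x v; apply: le_trans (ler_dual_norm _ _) _; rewrite ler_wpM2r//.
by apply: gM; [rewrite (le_lt_trans (ler_norm _))// ltrDl|exists x].
Qed.

(** Off a null set the pairing with the density is the limit of the pairings with simple functions,
    hence measurable. It is bounded by [M * (|f x - s n x| + C)], where [M] bounds [psi], [C] bounds
    [s n], and [n] makes the integral of the first term finite. *)
Lemma vdensity_integrable (mu : vmeasure (borel X) S) (psi : X -> dual S) :
  continuous psi -> exists2 g : borel X -> R,
    (vbase mu).-integrable setT (EFin \o g) &
    \forall x \ae vbase mu, psi x (vdensity mu x) = g x.
Proof.
move=> psic.
have [s [ss [N [mN N0 sN]] sint]] : bochner_integrable (vbase mu) (vdensity mu).
  by rewrite /vbase/vdensity; case: cid => r [].
set m := vbase mu in N0 sint *; set f := vdensity mu in sN sint *.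
have {}sN x : ~ N x -> s n x @[n --> \oo] --> f x.
  by move=> Nx; apply: contrapT => sfx; apply: Nx; exact: sN.
pose g (x : borel X) : R := (psi x (f x) : R) * \1_(~` N) x.
have mNC : measurable (~` N) by exact: measurableC.
have mg : measurable_fun setT g.
  apply: (@measurable_fun_cvg _ _ _ _
    (fun n (x : borel X) => (psi x (s n x) : R) * \1_(~` N) x)).
    move=> n; apply: measurable_funM => //.
    apply: (@simple_function_comp_measurable _ (borel X) R S (s n)
      (fun x v => psi x v)) => // v.
    apply: continuous_borel_measurable.
    exact: dual_eval_continuous.
  move=> x _; have [Nx|Nx] := pselect (N x).
    rewrite /g indicE memNset; last by move=> /(_ Nx).
    under eq_fun do rewrite mulr0.
    by rewrite mulr0; exact: cvg_cst.
  apply: cvgM; last exact: cvg_cst.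
  by apply: continuous_cvg; [exact: (dualP (psi x)).2|exact: sN].
exists g; last first.
  exists N; split=> // x /= gx; apply: contrapT => nN; apply: gx.
  by rewrite /g indicE mem_set ?mulr1.
have [n fsn] : exists n, (\int[m]_x `|f x - s n x|%:E < +oo)%E.
  have /sint : nbhs (0%E : \bar R) [set x | (x < +oo)%E].
    by apply: open_nbhs_nbhs; split; [exact: open_ereal_lt_ereal|exact: ltry].
  by move=> [n _ nP]; exists n; exact: (nP n (leqnn n)).
have [C sC] : exists C, forall x, `|s n x| <= C.
  have [fs _] := ss n; have /compact_bounded[M [_ hM]] := finite_compact fs.
  by exists (M + 1) => x; apply: (hM (M + 1)); [rewrite ltrDl|exists x].
have [M M0 psiM] := dual_bounded psic.
(* Since [|f - s n|] need not be measurable, it is replaced by a measurable [k] below it that still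
   satisfies [|g| <= M * (k + C)]. *)
pose k (x : borel X) : R := maxr (`|g x| / M - C) 0.
have k0 x : 0 <= k x by rewrite /k le_max lexx orbT.
have mk : measurable_fun setT k.
  apply: measurable_maxr; last exact: measurable_cst.
  apply: measurable_funB; last exact: measurable_cst.
  apply: measurable_funM; last exact: measurable_cst.
  exact: measurableT_comp.
have kfs x : k x <= `|f x - s n x|.
  rewrite /k ge_max normr_ge0 andbT lerBlDr ler_pdivrMr//.
  have : `|g x| <= M * `|f x|.
    apply: le_trans (psiM x (f x)); rewrite /g normrM ler_piMr//.
    by rewrite indicE ger0_norm ?ler0n// lern1 leq_b1.
  move=> /le_trans; apply; rewrite mulrC ler_pM2r//.
  rewrite -{1}(subrK (s n x) (f x)) (le_trans (ler_normD _ _))// lerD2l; exact: sC.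
have ik : m.-integrable setT (EFin \o k).
  apply/integrableP; split; first exact/measurable_EFinP.
  apply: le_lt_trans fsn; apply: ge0_le_integral_ae => //.
  by apply: aeW => y /=; rewrite lee_fin ger0_norm.
have iC : m.-integrable setT (EFin \o cst (M * C)).
  exact: finite_measure_integrable_cst.
apply: le_integrable (integrableD measurableT (integrableZl measurableT M ik) iC) => //.
  exact/measurable_EFinP.
move=> x _ /=; rewrite lee_fin (le_trans _ (ler_norm _))//.
rewrite -mulrDr mulrC -ler_pdivrMr// -lerBlDr.
by rewrite /k le_max lexx.
Qed.

Lemma vintegral_lin (mu : vmeasure (borel X) S) a (psi phi : X -> dual S) :
  continuous psi -> continuous phi ->
  vintegral mu (fun x => a *: psi x + phi x) =
  a * vintegral mu psi + vintegral mu phi.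
Proof.
move=> /(vdensity_integrable mu)[g ig psig] /(vdensity_integrable mu)[h ih phih].
have aeF := ae_filter_ringOfSetsType (vbase mu).
rewrite /vintegral.
have -> : \int[vbase mu]_w psi w (vdensity mu w) = \int[vbase mu]_w g w.
  by congr fine; apply: integral_ae_congr; apply: filterS psig => x ->.
have -> : \int[vbase mu]_w phi w (vdensity mu w) = \int[vbase mu]_w h w.
  by congr fine; apply: integral_ae_congr; apply: filterS phih => x ->.
rewrite -Rintegral_lin//; congr fine; apply: integral_ae_congr.
by apply: filterS2 psig phih => x px hx; rewrite dualD dualZ px hx.
Qed.

End vintegral_linear.

(** * Duality *)

Section duality.
Context {R : realType} {X Y : pointedMetricType R} {S : normedModType R}.
Variables (F : set (dual S)) (mu : vmeasure (borel X) S)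
  (nu : vmeasure (borel Y) S) (c : X * Y -> R) (eta : X * Y -> S).
Hypotheses (compactX : compact [set: X]) (compactY : compact [set: Y])
  (subF : linear_subspace F) (contc : continuous c)
  (bndeta : bounded_fun eta) (conteta : continuous (eta : X * Y -> weak_by F)).

Implicit Types (psi : X -> dual S) (phi : Y -> dual S).

(* The pointed and the pseudometric structures of the product are not joined in
   the library. *)
Let K : pseudoPMetricType R := HB.pack_for (pseudoPMetricType R) (X * Y)%type
  (PseudoMetric.on (X * Y)%type) (Pointed.on (X * Y)%type).

Let compactK : compact [set: K].
Proof. by rewrite -setXTT; exact: compact_setX. Qed.

Let hausdorffK : hausdorff_space K.
Proof.
have fstc : continuous (fst : K -> X) by move=> x; exact: cvg_fst.
have sndc : continuous (snd : K -> Y) by move=> x; exact: cvg_snd.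
move=> [x y] [x' y'] xy; congr pair.
  apply: (@metric_hausdorff R X) => A B Ax Bx'.
  have [z [Az Bz]] := xy (fst @^-1` A) (fst @^-1` B) (fstc (x, y) A Ax)
    (fstc (x', y') B Bx').
  by exists z.1.
apply: (@metric_hausdorff R Y) => A B Ay By'.
have [z [Az Bz]] := xy (snd @^-1` A) (snd @^-1` B) (sndc (x, y) A Ay)
  (sndc (x', y') B By').
by exists z.2.
Qed.

Let graph_measure (G : set ((X * Y -> R) * R)) r1 :
    graph_linear G -> graph_positive G -> G (fun=> 1, r1) ->
  exists p : {finite_measure set (borel (X * Y)%type) -> \bar R},
    forall g r, continuous g -> G (g, r) -> \int[p]_z g z = r.
Proof.
move=> Gl Gp G1; exact: (@positive_graph_measure R K G r1).
Qed.

(** * Linearity and continuity of the pairings with [eta], and weak duality *)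

Definition pairing psi phi : X * Y -> R := fun z => (psi z.1 + phi z.2) (eta z).

Lemma continuous_into_lin (T : topologicalType) a (g h : T -> dual S) :
  continuous_into F g -> continuous_into F h ->
  continuous_into F (fun x => a *: g x + h x).
Proof.
move=> [gc gF] [hc hF]; split; last by move=> x; apply: subF.2.
by move=> x; apply: cvgD; [apply: cvgZl_tmp; exact: gc|exact: hc].
Qed.

Lemma continuous_into0 (T : topologicalType) :
  continuous_into F ((fun=> 0) : T -> dual S).
Proof. by split; [exact: cst_continuous|move=> x; exact: subF.1]. Qed.

Lemma pairing_lin a psi psi' phi phi' z :
  pairing (fun x => a *: psi x + psi' x) (fun y => a *: phi y + phi' y) z =
  a * pairing psi phi z + pairing psi' phi' z.
Proof. by rewrite /pairing !dualD !dualZ; ring. Qed.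

(** The difference splits into [g (h z)] at [eta z - eta w], small by weak continuity since
    [g (h z)] is in [F], and [g (h z) - g (h w)] at [eta w], small because [g] is norm continuous
    and [eta] bounded. The map [h] stands for either projection. *)
Lemma dual_eta_continuous (T : topologicalType) (h : X * Y -> T) (g : T -> dual S) :
  continuous h -> continuous_into F g -> continuous (fun z => g (h z) (eta z) : R).
Proof.
move=> hc [gc gF] z.
have [M M0 etaM] : exists2 M, 0 < M & forall w, `|eta w| <= M.
  have [M [_ hM]] := bndeta; exists (`|M| + 1); first by rewrite ltr_wpDl.
  by move=> w; apply: hM => //; rewrite (le_lt_trans (ler_norm _))// ltrDl.
apply/cvgrPdist_le => e e0.
have e2 : 0 < e / 2 by rewrite divr_gt0.
have d0 : 0 < e / 2 / M by rewrite divr_gt0.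
have near1 : \forall w \near z, `|g (h z) (eta z) - g (h z) (eta w)| <= e / 2.
  have : continuous (fun w => g (h z) (eta w) : R).
    exact: (continuous_weak_byP F eta).1 conteta _ (gF (h z)).
  by move=> /(_ z)/cvgrPdist_le; exact.
have near2 : \forall w \near z, `|g (h z) - g (h w)| <= e / 2 / M.
  have : g (h w) @[w --> z] --> g (h z).
    by apply: (continuous_comp (hc z)); exact: gc.
  by move=> /cvgrPdist_le; exact.
apply: filterS2 near1 near2 => w w1 w2.
rewrite (_ : _ - _ = (g (h z) (eta z) - g (h z) (eta w)) +
   (g (h z) - g (h w)) (eta w)); last first.
  have -> : (g (h z) - g (h w)) (eta w) = g (h z) (eta w) - g (h w) (eta w) by [].
  by rewrite addrA subrK.
rewrite (splitr e) (le_trans (ler_normD _ _))// lerD//.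
apply: le_trans (ler_dual_norm _ _) _.
apply: (@le_trans _ _ (e / 2 / M * M)); last by rewrite divfK// gt_eqF.
by apply: ler_pM => //; exact: (normr_ge0 (g (h z) - g (h w))).
Qed.

Lemma pairing_continuous psi phi : continuous_into F psi ->
  continuous_into F phi -> continuous (pairing psi phi).
Proof.
move=> ipsi iphi z; apply: (@cvgD _ R^o).
  by apply: (dual_eta_continuous (h := fst)) => // w; exact: cvg_fst.
by apply: (dual_eta_continuous (h := snd)) => // w; exact: cvg_snd.
Qed.

Lemma continuous_plan_integrable
    (p : {finite_measure set (borel (X * Y)%type) -> \bar R}) (g : X * Y -> R) :
  continuous g -> p.-integrable setT (EFin \o g).
Proof.
move=> gc; apply: fbounded_integrable.
  exact: (@continuous_borel_measurable R K).
exact: (@compact_continuous_fbounded R (X * Y)%type).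
Qed.

Let dual_value psi phi := vintegral mu psi + vintegral nu phi.

Let dual_value_lin a psi psi' phi phi' :
  continuous_into F psi -> continuous_into F psi' ->
  continuous_into F phi -> continuous_into F phi' ->
  dual_value (fun x => a *: psi x + psi' x) (fun y => a *: phi y + phi' y) =
  a * dual_value psi phi + dual_value psi' phi'.
Proof.
move=> [? _] [? _] [? _] [? _].
by rewrite /dual_value !vintegral_lin//; ring.
Qed.

Lemma weak_duality (p : {finite_measure set (borel (X * Y)%type) -> \bar R}) q :
  plans F mu nu eta p -> potentials F c eta q ->
  vintegral mu q.1 + vintegral nu q.2 <= \int[p]_z c z.
Proof.
move=> pp [q1 q2 qc]; rewrite (pp _ _ q1 q2).
apply: le_Rintegral => //; try exact: continuous_plan_integrable.
  by apply: continuous_plan_integrable; exact: pairing_continuous.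
by move=> [x y] _; exact: qc.
Qed.

(** * Strong duality *)

Variable (f : X -> dual S).
Hypotheses (intof : continuous_into F f)
  (f_eta : forall x y, f x (eta (x, y)) = 1).

Let pairing_f z : pairing f (fun=> 0) z = 1.
Proof.
case: z => x y; rewrite /pairing dualD/= f_eta.
by rewrite [X in _ + X](_ : _ = 0) ?addr0.
Qed.

(** A relation is needed here: different pairs may have equal pairings, and their dual values are
    known to agree only once positivity is established. *)
Definition pairing_graph : set ((X * Y -> R) * R) :=
  [set p | exists psi phi, [/\ continuous_into F psi, continuous_into F phi &
     p = (pairing psi phi, vintegral mu psi + vintegral nu phi)]].

Let pairing_graph_linear : graph_linear pairing_graph.
Proof.
move=> a _ _ _ _ [psi [phi [ipsi iphi [-> ->]]]]
  [psi' [phi' [ipsi' iphi' [-> ->]]]].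
exists (fun x => a *: psi x + psi' x), (fun y => a *: phi y + phi' y).
split; [exact: continuous_into_lin..|congr pair].
- by apply/funext => z; rewrite pairing_lin.
- exact/esym/dual_value_lin.
Qed.

Let pairing_graph1 : pairing_graph (fun=> 1, vintegral mu f + vintegral nu (fun=> 0)).
Proof.
exists f, (fun=> 0); split => //; first exact: continuous_into0.
by congr pair; apply/funext => z; rewrite pairing_f.
Qed.

Let dual_values := graph_below pairing_graph c.

Let dual_valuesP r : dual_values r <-> exists2 q, potentials F c eta q &
  r = vintegral mu q.1 + vintegral nu q.2.
Proof.
split=> [[_ [psi [phi [ipsi iphi [-> ->]]]] le_c]|[[psi phi] [ipsi iphi le_c] ->]].
  by exists (psi, phi) => //; split=> // x y; exact: (le_c (x, y)).
by exists (pairing psi phi); [exists psi, phi|move=> [x y]; exact: le_c].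
Qed.

Let c_fbounded : fbounded c.
Proof. exact: (@compact_continuous_fbounded R K). Qed.

Let const_graph a : exists r, pairing_graph (fun=> a, r).
Proof.
eexists; have := pairing_graph_linear (a - 1) pairing_graph1 pairing_graph1.
congr pairing_graph; congr pair; apply/funext => z; ring.
Qed.

(** A constant below [c] is a pairing, because [f] pairs to 1 with [eta]. *)
Lemma potential_exists : potentials F c eta !=set0.
Proof.
have [C cC] := c_fbounded; have [r rC] := const_graph (- C).
have /dual_valuesP[q qp _] : dual_values r; last by exists q.
by exists (fun=> - C) => // z; have := cC z; rewrite ler_norml => /andP[].
Qed.

(** Bounded dual values make the graph positive. It is first extended by the value [sup V] at [c],
    then represented by a measure. As the pairings and [c] are continuous, this measure is a plan
    and its cost is [sup V]. *)
Lemma optimal_plan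
    (V := [set vintegral mu q.1 + vintegral nu q.2 | q in potentials F c eta]) :
  has_ubound V -> exists2 p, plans F mu nu eta p & \int[p]_z c z = sup V.
Proof.
have <- : dual_values = V.
  apply/seteqP; split=> r.
    by move=> /dual_valuesP[q qp ->]; exists q.
  by move=> [q qp <-]; apply/dual_valuesP; exists q.
move=> [D ubD].
have Gp := graph_positive_of_ubound pairing_graph_linear pairing_graph1
  c_fbounded ubD.
have [C cC] := c_fbounded.
have [r1 rC1] := const_graph (- C); have [r2 rC2] := const_graph C.
have [|z|G [Gl' Gp' GG' Gc]] :=
    graph_extend1 pairing_graph_linear Gp rC1 _ rC2 (g0 := c).
- by move=> z; have := cC z; rewrite ler_norml => /andP[].
- by have := cC z; rewrite ler_norml => /andP[].
have [p pE] := graph_measure Gl' Gp' (GG' _ pairing_graph1).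
exists p; last exact: pE.
move=> psi phi ipsi iphi; apply/esym/pE; first exact: pairing_continuous.
by apply: GG'; exists psi, phi.
Qed.

End duality.

Theorem theorem3p21 (R : realType) (X Y : pointedMetricType R)
    (S : completeNormedModType R) (F : set (dual S))
    (mu : vmeasure (borel X) S) (nu : vmeasure (borel Y) S)
    (c : X * Y -> R) (eta : X * Y -> S)
    (compactX : compact [set: X]) (compactY : compact [set: Y])
    (subF : linear_subspace F) (sepF : separates_points F)
    (contc : continuous c)
    (bndeta : bounded_fun eta) (conteta : continuous (eta : X * Y -> weak_by F))
    (exf : exists2 f : X -> dual S, continuous_into F f &
             forall x y, f x (eta (x, y)) = 1) :
  let cost (p : {finite_measure set (borel (X * Y)%type) -> \bar R}) : \bar R :=
    (\int[p]_z c z)%:E in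
  let dual_value (q : (X -> dual S) * (Y -> dual S)) : \bar R :=
    (vintegral mu q.1 + vintegral nu q.2)%:E in
  ereal_inf (cost @` plans F mu nu eta)
    = ereal_sup (dual_value @` potentials F c eta) /\
  (plans F mu nu eta !=set0 ->
   exists2 p, plans F mu nu eta p & cost p = ereal_inf (cost @` plans F mu nu eta)).
Proof.
have [f intof f_eta] := exf; move=> cost dual_value.
pose V := [set vintegral mu q.1 + vintegral nu q.2 | q in potentials F c eta].
have weak p r : plans F mu nu eta p -> V r -> r <= \int[p]_z c z.
  by move=> pp [q qp <-]; apply: weak_duality pp qp.
have V0 : V !=set0.
  have [q qp] := potential_exists mu nu compactX compactY subF contc intof
    f_eta.
  by exists (vintegral mu q.1 + vintegral nu q.2), q.
have -> : dual_value @` potentials F c eta = EFin @` V.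
  by rewrite /V image_comp.
(* If the dual values are unbounded, weak duality leaves no plan and both sides are [+oo]. *)
have [ubV|nubV] := pselect (has_ubound V); last first.
  have noplan : plans F mu nu eta = set0.
    apply/seteqP; split=> // p pp; apply: nubV; exists (\int[p]_z c z) => r.
    exact: weak.
  by rewrite noplan image_set0 ereal_inf0 hasNub_ereal_sup//; split=> // -[].
have [p pp pc] : exists2 p, plans F mu nu eta p & \int[p]_z c z = sup V.
  exact: (optimal_plan compactX compactY subF contc bndeta conteta intof f_eta).
have infE : ereal_inf (cost @` plans F mu nu eta) = (sup V)%:E.
  apply/eqP; rewrite eq_le; apply/andP; split.
    by apply: ereal_inf_lbound; exists p; rewrite // /cost pc.
  apply: le_ereal_inf_tmp => _ [p' pp' <-]; rewrite lee_fin.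
  by apply: ge_sup => // r; exact: weak.
rewrite infE ereal_sup_EFin//; split=> // _.
by exists p; rewrite // /cost pc.
Qed.
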